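(* The right trapezoid $R\left(\frac{\pi}{3},\frac18\right)$ is rep-$25$ but is not rep-$n$ for any integer $n$ with $1<n<25$.
   Context: $R(\vartheta,a)$ denotes the right trapezoid (not a parallelogram) whose acute internal angle is $\vartheta$, whose longer leg has length $1$ (so the shorter leg, perpendicular to the bases, has length $\sin\vartheta$), and whose shorter base has length $a$ (so the longer base has length $a+\cos\vartheta$). A planar figure is rep-$n$ if it can be dissected into $n$ similar copies of itself that are congruent to each other (reflected copies are allowed). *)

(* Defs.v *)
From HB Require Import structures.
From mathcomp Require Import all_boot all_order all_algebra.
From mathcomp Require Import all_classical all_reals all_analysis.

Set Implicit Arguments.
Unset Strict Implicit.
Unset Printing Implicit Defensive.

Import Order.TTheory GRing.Theory Num.Theory.
Import numFieldNormedType.Exports.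

Local Open Scope classical_set_scope.
Local Open Scope ring_scope.

(* The library norm on [R * R] is the sup norm, so the Euclidean distance is
   defined here; both induce the same topology, hence the same interiors. *)
Definition edist (R : realType) (p q : R * R) : R :=
  Num.sqrt ((p.1 - q.1) ^+ 2 + (p.2 - q.2) ^+ 2).

(* Orientation-reversing maps are included. *)
Definition similarity (R : realType) (c : R) (f : R * R -> R * R) : Prop :=
  forall p q, edist (f p) (f q) = c * edist p q.

Definition similar (R : realType) (A B : set (R * R)) : Prop :=
  exists c : R, exists f : R * R -> R * R,
    [/\ 0 < c, similarity c f & B = f @` A].

Definition congruent (R : realType) (A B : set (R * R)) : Prop :=
  exists2 f : R * R -> R * R, similarity 1 f & B = f @` A.

Definition dissection (R : realType) (n : nat) (A : set (R * R))
    (P : 'I_n -> set (R * R)) : Prop :=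
  \bigcup_(i in [set: 'I_n]) P i = A /\
  trivIset [set: 'I_n] (fun i => interior (P i)).

Definition rep (R : realType) (n : nat) (A : set (R * R)) : Prop :=
  exists P : 'I_n -> set (R * R),
    [/\ dissection A P,
        (forall i, similar A (P i)) &
        (forall i j, congruent (P i) (P j))].

Definition convex_hull (R : realType) (V : set (R * R)) : set (R * R) :=
  smallest [set A : set (R * R) | convex_set A] V.

(* A representative of the congruence class of R(theta, a), meaningful for
   0 < theta < pi / 2 and 0 < a.  The longer base lies on the first axis, the
   angle theta is at the origin, and the last two vertices span the
   perpendicular leg. *)
Definition right_trapezoid (R : realType) (theta a : R) : set (R * R) :=
  convex_hull [set v | v \in [:: (0, 0);
                                 (cos theta, sin theta);
                                 (a + cos theta, sin theta);
                                 (a + cos theta, 0)]].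

(* Main.v *)
Require Import Defs.
From HB Require Import structures.
From mathcomp Require Import all_boot all_order all_algebra.
From mathcomp Require Import all_classical all_reals all_analysis.
From mathcomp Require Import measurable_realfun ring lra.

Import Order.TTheory GRing.Theory Num.Theory.
Import numFieldNormedType.Exports.

Local Open Scope classical_set_scope.
Local Open Scope ring_scope.

(** Write r for the square root of 3.  In the standard position the trapezoid is
    cut out by the four inequalities 0 <= y <= r/2, x <= 5/8, y <= r x; its sides
    have lengths 5/8 (bottom), 1 (slanted), 1/8 (top) and r/2 (vertical, on the
    right).  All the copies in a dissection are images of it under similarities
    with a common ratio c.

    Why fewer than 25 tiles are impossible.  Comparing areas, n c^2 >= 1, so
    n < 25 gives c > 1/5, and n > 1 forces c < 1.  A tile touching the top base
    of the big trapezoid in more than one point has a whole side on it.  The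
    sides of a tile other than its own short base are at least 5c/8 > 1/8 long,
    which is too much; hence the tile is a scaled copy of the big trapezoid,
    placed below the top line, possibly reflected in a vertical line
    (top_tile).  Consider a tile at the top right corner.  The angle there is a
    right angle, so that tile is not reflected: its obtuse angle of 120 degrees
    is at the left end of its short base (corner_tile).  Since c < 1 the top base
    goes on to the left, and the next tile also has its short base on it, with an
    angle of at least 90 degrees at the common end.  As 120 + 90 > 180 the two
    tiles overlap (no_dissection).  The formal argument replaces exact contact by
    tiles that contain two points of a short window of the top base, which the
    pigeonhole principle provides (top_window), and it exhibits a common interior
    point.

    Why 25 tiles suffice.  An explicit dissection is given, with tiles turned by
    multiples of 60 degrees; in the coordinates 80 x and 80 y / r all its
    vertices are integral, so that inclusion in the big trapezoid and separation
    of every two tiles by a line become finite computations on integers.  That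
    the tiles leave no hole needs no further inspection: they have disjoint
    interiors and total area equal to that of the big trapezoid, so a hole, which
    would contain an open set, has no room (area_filling).

    Both halves rest on the same fact on areas: a similarity of ratio c multiplies
    them by c^2 (similarity_area). *)

(** The plane with the product of the Borel sigma-algebras of the two axes. *)
Local Notation plane R := (measurableTypeR R * measurableTypeR R)%type.

(** * Area of affine images *)

Definition affine_map {R : realType} (a b e c d h : R) (p : R * R) : R * R :=
  (a * p.1 + b * p.2 + e, c * p.1 + d * p.2 + h).

Section Area.
Variable R : realType.
Implicit Types a b c d e h : R.

Definition area : {measure set (plane R) -> \bar R} :=
  (lebesgue_measure \x lebesgue_measure)%E.

(** Up to the factor |b| the preimage map is a measure, and it takes the right
    values on half-open intervals. *)
Lemma length_affine_preimage b k (X : set R) : b != 0 -> measurable X ->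
  (lebesgue_measure ((fun y => b * y + k)%R @^-1` X : set (measurableTypeR R))
   = (`|b|^-1)%:E * lebesgue_measure X)%E.
Proof.
move=> b0 mX.
pose f : measurableTypeR R -> measurableTypeR R := fun y => b * y + k.
have mf : measurable_fun [set: measurableTypeR R] f.
  by apply: measurable_funD => //; exact: measurable_funM.
have nb0 : 0 <= `|b| by [].
pose nu : {measure set (measurableTypeR R) -> \bar R} :=
  mscale (NngNum nb0) (pushforward lebesgue_measure f).
suff E : lebesgue_measure X = nu mf X.
  rewrite E /nu /mscale /= /pushforward muleA -EFinM mulVf ?mul1e //.
  by rewrite normr_eq0.
apply: lebesgue_measure_unique => //= _ [[x y] /= xy] <-.
rewrite /mscale /= /pushforward /=.
rewrite lebesgue_measure_itv/= lte_fin.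
have [bp|bn|/eqP] := ltgtP b 0; last by rewrite (negbTE b0).
- have -> : f @^-1` `]x, y] = [set` `[(y - k) / b, (x - k) / b[].
    apply/seteqP; split=> z /=; rewrite !in_itv/= /f.
      by rewrite ler_ndivrMr // ltr_ndivlMr // => /andP[? ?]; apply/andP; split; lra.
    by rewrite ler_ndivrMr // ltr_ndivlMr // => /andP[? ?]; apply/andP; split; lra.
  rewrite lebesgue_measure_itv/= lte_fin ltr_nM2r ?invr_lt0 //.
  rewrite ltrD2r ltr0_norm //; case: ifP => _; last by rewrite mule0.
  by rewrite -!EFinD -EFinM; congr EFin; field.
- have -> : f @^-1` `]x, y] = [set` `](x - k) / b, (y - k) / b]].
    apply/seteqP; split=> z /=; rewrite !in_itv/= /f.
      by rewrite ler_pdivlMr // ltr_pdivrMr // => /andP[? ?]; apply/andP; split; lra.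
    by rewrite ler_pdivlMr // ltr_pdivrMr // => /andP[? ?]; apply/andP; split; lra.
  rewrite lebesgue_measure_itv/= lte_fin ltr_pM2r ?invr_gt0 //.
  rewrite ltrD2r gtr0_norm //; case: ifP => _; last by rewrite mule0.
  by rewrite -!EFinD -EFinM; congr EFin; field.
Qed.

Lemma measurable_affine_form a b e :
  measurable_fun [set: plane R]
    (fun p => a * p.1 + b * p.2 + e : measurableTypeR R).
Proof.
apply: measurable_funD => //; apply: measurable_funD => //.
  by apply: measurable_funM => //; exact: measurable_fst.
by apply: measurable_funM => //; exact: measurable_snd.
Qed.

Lemma measurable_affine_map a b e c d h :
  measurable_fun [set: plane R]
    (affine_map a b e c d h : _ -> plane R).
Proof. by apply: measurable_fun_pair; exact: measurable_affine_form. Qed.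

Lemma measurable_affine_preimage a b e c d h (S : set (plane R)) :
  measurable S ->
  measurable (affine_map a b e c d h @^-1` S : set (plane R)).
Proof.
move=> mS; rewrite -[X in measurable X]setTI.
exact: measurable_affine_map.
Qed.

(** Exchanging the coordinates exchanges the two orders of integration, and both
    orders define the product measure. *)
Lemma area_swap (S : set (plane R)) :
  measurable S -> area (affine_map 0 1 0 1 0 0 @^-1` S) = area S.
Proof.
move=> mS; rewrite /area /=.
rewrite [RHS](_ : _ = (product_measure2 lebesgue_measure lebesgue_measure) S); last first.
  apply: product_measure_unique => //= A B mA mB; exact: product_measure2E.
rewrite /product_measure1 /product_measure2; apply: eq_integral => x _ /=.
congr (lebesgue_measure _); apply/seteqP; split=> y.
  by rewrite /xsection /ysection /= !inE /= /affine_map /= !mul0r !mul1r !addr0 add0r.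
by rewrite /xsection /ysection /= !inE /= /affine_map /= !mul0r !mul1r !addr0 add0r.
Qed.

(** By Fubini: on each vertical line the map is affine with slope b. *)
Lemma area_shear b a e (S : set (plane R)) :
  b != 0 -> measurable S ->
  area (affine_map 1 0 0 a b e @^-1` S) = ((`|b|^-1)%:E * area S)%E.
Proof.
move=> b0 mS; rewrite /area /= /product_measure1.
rewrite -ge0_integralZl //; last exact: measurable_fun_xsection.
apply: eq_integral => x _ /=.
rewrite -(@length_affine_preimage b (a * x + e)) //; last exact: measurable_xsection.
congr (lebesgue_measure _); apply/seteqP; split=> y.
  by rewrite /xsection /= !inE /= /affine_map /= !mul0r !mul1r !addr0 addrAC addrC addrA.
by rewrite /xsection /= !inE /= /affine_map /= !mul0r !mul1r !addr0
  addrA [b * y + _]addrC addrAC.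
Qed.

(** If b is nonzero, the map replaces y by a x + b y + e, exchanges the
    coordinates, and then changes the second one again with slope
    c - d a / b = - det / b.  If b = 0, a preliminary exchange of the coordinates
    reduces to the case where b is nonzero. *)
Lemma area_affine_preimage a b e c d h (S : set (plane R)) :
  a * d - b * c != 0 -> measurable S ->
  area (affine_map a b e c d h @^-1` S) = ((`|a * d - b * c|^-1)%:E * area S)%E.
Proof.
have main a' b' e' c' d' h' : b' != 0 -> a' * d' - b' * c' != 0 ->
    measurable S -> area (affine_map a' b' e' c' d' h' @^-1` S)
    = ((`|a' * d' - b' * c'|^-1)%:E * area S)%E.
  move=> b0 D0 mS.
  have q0 : c' - d' * a' / b' != 0.
    apply: contra D0 => /eqP E; apply/eqP.
    have -> : a' * d' - b' * c' = - b' * (c' - d' * a' / b') by field.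
    by rewrite E mulr0.
  pose L1 : R * R -> R * R := affine_map 1 0 0 a' b' e'.
  pose L2 : R * R -> R * R :=
    affine_map 1 0 0 (d' / b') (c' - d' * a' / b') (h' - d' * e' / b').
  pose sw : R * R -> R * R := affine_map 0 1 0 1 0 0.
  have E : affine_map a' b' e' c' d' h' = fun p => L2 (sw (L1 p)).
    by apply/funext => -[x y]; rewrite /L2 /sw /L1 /affine_map /=; congr pair; field.
  have -> : affine_map a' b' e' c' d' h' @^-1` S = L1 @^-1` (sw @^-1` (L2 @^-1` S)).
    by rewrite E.
  have mL : measurable (L2 @^-1` S : set (plane R)).
    exact: measurable_affine_preimage.
  rewrite area_shear //; last exact: measurable_affine_preimage.
  rewrite area_swap // area_shear // muleA -EFinM -invfM -normrM.
  by congr ((_^-1)%:E * _)%E; rewrite -normrN; congr (`|_|); field.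
move=> D0 mS; have [b0|b0] := eqVneq b 0; last exact: main.
have a0 : a != 0 by apply: contra D0 => /eqP->; rewrite b0 !mul0r subrr.
have mG := @measurable_affine_preimage a b e c d h _ mS.
rewrite -area_swap //.
have E : affine_map b a e d c h
    = (fun p => affine_map a b e c d h (affine_map 0 1 0 1 0 0 p)) :> (R * R -> R * R).
  by apply/funext => -[x y]; rewrite /affine_map /=; congr pair; ring.
have -> : affine_map 0 1 0 1 0 0 @^-1` (affine_map a b e c d h @^-1` S)
    = affine_map b a e d c h @^-1` S by rewrite E.
rewrite main //; first by rewrite -[b * c - _]opprB normrN.
by rewrite -opprB oppr_eq0.
Qed.

End Area.

Arguments area {R}.

(** * Similarities of the plane *)

Section Similarities.
Variable R : realType.
Implicit Types (p q : R * R) (f g : R * R -> R * R).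

Lemma edist_sq p q : Defs.edist p q ^+ 2 = (p.1 - q.1) ^+ 2 + (p.2 - q.2) ^+ 2.
Proof. by rewrite sqr_sqrtr // addr_ge0 // sqr_ge0. Qed.

(** By polarization, f - f (0, 0) multiplies scalar products by c^2; hence it
    sends the standard basis to two orthogonal vectors (u, v) and s (- v, u) of
    length c, and it is the linear map that they define.  Here s = 1 or s = -1 is
    the orientation. *)
Lemma similarity_affine c f : 0 < c -> similarity c f ->
  exists u v s e h : R, [/\ u ^+ 2 + v ^+ 2 = c ^+ 2, s ^+ 2 = 1 &
    f = affine_map u (- (s * v)) e v (s * u) h].
Proof.
move=> c0 fc.
have fd p q : ((f p).1 - (f q).1) ^+ 2 + ((f p).2 - (f q).2) ^+ 2
    = c ^+ 2 * ((p.1 - q.1) ^+ 2 + (p.2 - q.2) ^+ 2).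
  by rewrite -!edist_sq fc exprMn.
pose X p := (f p).1 - (f (0, 0)).1; pose Y p := (f p).2 - (f (0, 0)).2.
have dot p q : X p * X q + Y p * Y q = c ^+ 2 * (p.1 * q.1 + p.2 * q.2).
  have := fd p q; have := fd p (0, 0); have := fd q (0, 0).
  by rewrite /X /Y /=; lra.
have c20 : c ^+ 2 != 0 by rewrite expf_neq0 // gt_eqF.
pose u := X (1, 0); pose v := Y (1, 0); pose w := X (0, 1); pose z := Y (0, 1).
have uv : u ^+ 2 + v ^+ 2 = c ^+ 2.
  by have := dot (1, 0) (1, 0); rewrite -/u -/v /=; lra.
have wz : w ^+ 2 + z ^+ 2 = c ^+ 2.
  by have := dot (0, 1) (0, 1); rewrite -/w -/z /=; lra.
have uw : u * w + v * z = 0.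
  by have := dot (1, 0) (0, 1); rewrite -/u -/v -/w -/z /=; lra.
(* The orientation is the determinant divided by its absolute value. *)
pose s := (u * z - v * w) / c ^+ 2.
have D2 : (u * z - v * w) ^+ 2 = c ^+ 2 * c ^+ 2.
  rewrite -{1}uv -wz.
  have -> : (u ^+ 2 + v ^+ 2) * (w ^+ 2 + z ^+ 2)
     = (u * z - v * w) ^+ 2 + (u * w + v * z) ^+ 2 by ring.
  by rewrite uw expr0n addr0.
have s2 : s ^+ 2 = 1 by rewrite exprMn D2 exprVn -expr2 divff // expf_neq0.
have sc : s * c ^+ 2 = u * z - v * w by rewrite mulfVK.
have wE : w = - (s * v).
  apply: (mulfI c20); rewrite mulrN mulrA [c ^+ 2 * s]mulrC sc -uv.
  have -> : (u ^+ 2 + v ^+ 2) * w = u * (u * w + v * z) - (u * z - v * w) * v by ring.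
  by rewrite uw; ring.
have zE : z = s * u.
  apply: (mulfI c20); rewrite mulrA [c ^+ 2 * s]mulrC sc -uv.
  have -> : (u ^+ 2 + v ^+ 2) * z = v * (u * w + v * z) + (u * z - v * w) * u by ring.
  by rewrite uw; ring.
exists u, v, s, (f (0, 0)).1, (f (0, 0)).2; split=> //.
apply/funext => p; rewrite [f p]surjective_pairing /affine_map.
have p1 := dot p (1, 0); have p2 := dot p (0, 1).
rewrite /= -/u -/v -/w -/z in p1 p2.
have E1 : u * X p + v * Y p = c ^+ 2 * p.1 by move: p1; lra.
have E2 : u * Y p - v * X p = s * (c ^+ 2 * p.2).
  rewrite -[LHS]mul1r -s2 expr2 -mulrA; congr (s * _).
  by move: p2; rewrite wE zE; lra.
have X1 : X p = u * p.1 + - (s * v) * p.2.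
  apply: (mulfI c20); rewrite -{1}uv.
  have -> : (u ^+ 2 + v ^+ 2) * X p
    = u * (u * X p + v * Y p) - v * (u * Y p - v * X p) by ring.
  by rewrite E1 E2; ring.
have Y1 : Y p = v * p.1 + s * u * p.2.
  apply: (mulfI c20); rewrite -{1}uv.
  have -> : (u ^+ 2 + v ^+ 2) * Y p
    = v * (u * X p + v * Y p) + u * (u * Y p - v * X p) by ring.
  by rewrite E1 E2; ring.
by rewrite -X1 -Y1 !subrK.
Qed.

(** An explicit affine inverse, the transpose of the linear part divided by
    c^2. *)
Lemma similarity_inverse c f : 0 < c -> similarity c f ->
  exists a b e c' d h : R, [/\ `|a * d - b * c'|^-1 = c ^+ 2,
    cancel f (affine_map a b e c' d h) & cancel (affine_map a b e c' d h) f].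
Proof.
move=> c0 /(similarity_affine _ _ c0)[u [v [s [e [h [uv s2 ->]]]]]].
have c2 : c ^+ 2 != 0 by rewrite expf_neq0 // gt_eqF.
have n0 : u ^+ 2 + v ^+ 2 != 0 by rewrite uv.
pose N := u ^+ 2 + v ^+ 2.
have s2' : s * s = 1 by rewrite -expr2.
exists (u / N), (v / N), (- (u * e + v * h) / N),
  (- (s * v) / N), (s * u / N), (s * (v * e - u * h) / N); split.
- have -> : u / N * (s * u / N) - v / N * (- (s * v) / N) = s / N.
    by rewrite /N; field.
  rewrite normrM normfV [ `|N|]ger0_norm ?addr_ge0 ?sqr_ge0 //.
  have -> : `|s| = 1.
    apply/eqP; rewrite -(@eqrXn2 _ 2) // ?normr_ge0 // expr1n.
    by rewrite -normrX s2 normr1.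
  by rewrite mul1r invrK /N uv.
- move=> -[x y]; rewrite /affine_map /=; congr pair.
    by rewrite /N; field.
  transitivity (s * s * y); last by rewrite s2' mul1r.
  by rewrite /N; field.
- move=> -[x y]; rewrite /affine_map /=; congr pair.
    transitivity (u / N * (u * x + v * y) - (s * s) * (v / N) * (u * y - v * x)
       + (e - u / N * (u * e + v * h) - (s * s) * (v / N) * (v * e - u * h))).
      by ring.
    by rewrite s2' /N; field.
  transitivity (v / N * (u * x + v * y) + (s * s) * (u / N) * (u * y - v * x)
       + (h - v / N * (u * e + v * h) + (s * s) * (u / N) * (v * e - u * h))).
    by ring.
  by rewrite s2' /N; field.
Qed.

Lemma affine_form_continuous (a b e : R) :
  continuous (fun p : R * R => a * p.1 + b * p.2 + e).
Proof.
move=> p; apply: cvgD; last exact: cvg_cst.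
apply: cvgD; apply: cvgM; try exact: cvg_cst; [exact: cvg_fst|exact: cvg_snd].
Qed.

Lemma affine_map_continuous a b e c d h :
  continuous (affine_map a b e c d h : R * R -> R * R).
Proof.
move=> p; have F := @affine_form_continuous.
exact: (@cvg_pair _ _ _ (nbhs p) _ _ _ _ _ (fun p : R * R => a * p.1 + b * p.2 + e)
  (fun p : R * R => c * p.1 + d * p.2 + h) (F a b e p) (F c d h p)).
Qed.

Section Image.
Variables (c : R) (f : R * R -> R * R).
Hypotheses (c_gt0 : 0 < c) (fc : similarity c f).

(** Images become preimages under an affine map, which preserve open, closed and
    measurable sets. *)
Lemma similarity_image_preimage : exists a b e c' d h : R,
  `|a * d - b * c'|^-1 = c ^+ 2 /\
  forall S : set (R * R), f @` S = affine_map a b e c' d h @^-1` S.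
Proof.
have [a [b [e [c' [d [h [D fK gK]]]]]]] := similarity_inverse _ _ c_gt0 fc.
exists a, b, e, c', d, h; split=> // S; apply/seteqP; split=> [_ [p Sp <-]|p Sp].
  by rewrite /= fK.
by exists (affine_map a b e c' d h p) => //; rewrite gK.
Qed.

Lemma similarity_open S : open S -> open (f @` S).
Proof.
have [a [b [e [c' [d [h [_ ->]]]]]]] := similarity_image_preimage.
by move=> oS; apply: open_comp => // p _; exact: affine_map_continuous.
Qed.

Lemma similarity_closed S : closed S -> closed (f @` S).
Proof.
have [a [b [e [c' [d [h [_ ->]]]]]]] := similarity_image_preimage.
by move=> cS; apply: closed_comp => // p _; exact: affine_map_continuous.
Qed.

Lemma similarity_area (S : set (plane R)) :
  measurable S ->
  measurable (f @` S : set (plane R)) /\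
  area (f @` S) = ((c ^+ 2)%:E * area S)%E.
Proof.
have [a [b [e [c' [d [h [D ->]]]]]]] := similarity_image_preimage.
move=> mS; split; first exact: measurable_affine_preimage.
rewrite area_affine_preimage ?D //.
rewrite -normr_eq0 -invr_eq0 D expf_neq0 // gt_eqF //.
Qed.

End Image.
End Similarities.

(** * The trapezoid as an intersection of half-planes *)

Section Trapezoid.
Variable R : realType.
Implicit Types (p q : R * R).

(** With x = pi / 3, the triple angle formula for cos (3 x) = -1 reads
    (cos x + 1) (2 cos x - 1)^2 = 0, and cos x > 0. *)
Lemma cos_pi3 : cos (pi / 3 : R) = 1 / 2.
Proof.
set x : R := pi / 3.
have pi0 := pi_gt0 R.
have c0 : 0 < cos x.
  by apply: cos_gt0_pihalf; rewrite /x; apply/andP; split; lra.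
have E : cos (x + x + x) = -1 by rewrite -[RHS]cospi; congr cos; rewrite /x; field.
have s2 := cos2Dsin2 x.
have F : (cos x + 1) * (2 * cos x - 1) ^+ 2 = 0.
  rewrite !cosD !sinD in E.
  have s2' : sin x ^+ 2 = 1 - cos x ^+ 2 by lra.
  have -> : (cos x + 1) * (2 * cos x - 1) ^+ 2
    = 1 + (cos x ^+ 3 - 3 * cos x * (1 - cos x ^+ 2)) by ring.
  rewrite -s2'; have -> : cos x ^+ 3 - 3 * cos x * sin x ^+ 2 = -1.
    by rewrite -E; ring.
  by rewrite subrr.
move/eqP: F; rewrite mulf_eq0 expf_eq0 /= => /orP[/eqP ?|/eqP ?]; lra.
Qed.

Lemma sin_pi3 : sin (pi / 3 : R) = Num.sqrt 3 / 2.
Proof.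
have pi0 := pi_gt0 R.
have s0 : 0 <= sin (pi / 3 : R).
  by apply/ltW/sin_gt0_pi; apply/andP; split; lra.
have t0 : 0 <= Num.sqrt 3 / 2 :> R by rewrite divr_ge0 ?sqrtr_ge0.
apply/eqP; rewrite -(@eqrXn2 _ 2) //.
rewrite exprMn sqr_sqrtr ?ler0n // sin2cos2 cos_pi3; apply/eqP; lra.
Qed.

Let r : R := Num.sqrt 3.
Let r_gt0 : 0 < r. Proof. by rewrite sqrtr_gt0. Qed.

Definition trapezoid : set (R * R) :=
  [set p | [/\ 0 <= p.2, p.2 <= r / 2, p.1 <= 5 / 8 & p.2 <= r * p.1]].

Definition open_trapezoid : set (R * R) :=
  [set p | [/\ 0 < p.2, p.2 < r / 2, p.1 < 5 / 8 & p.2 < r * p.1]].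

Lemma half_plane_convex a b e :
  convex_set [set p : R * R | a * p.1 + b * p.2 + e <= 0].
Proof.
move=> x y t; rewrite !inE /= => hx hy.
have t0 : 0 <= t%:num by []. have t1 : t%:num <= 1 by [].
change (a * (t%:num * x.1 + (1 - t%:num) * y.1)
  + b * (t%:num * x.2 + (1 - t%:num) * y.2) + e <= 0).
nra.
Qed.

Lemma convex_set_combination (C : set (R * R)) x y (t : R) : convex_set C -> C x -> C y ->
  0 <= t -> t <= 1 -> C (t * x.1 + (1 - t) * y.1, t * x.2 + (1 - t) * y.2).
Proof.
move=> cC Cx Cy t0 t1; apply/set_mem.
by apply: (cC _ _ (Itv01 t0 t1)); exact: mem_set.
Qed.

Lemma trapezoid_convex : convex_set trapezoid.
Proof.
move=> x y t /set_mem[x1 x2 x3 x4] /set_mem[y1 y2 y3 y4].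
have t0 : 0 <= t%:num by []. have t1 : 0 <= 1 - t%:num by rewrite subr_ge0.
apply/mem_set; change (trapezoid
  (t%:num * x.1 + (1 - t%:num) * y.1, t%:num * x.2 + (1 - t%:num) * y.2)).
move: (t%:num) t0 t1 => u u0 v0; split=> /=; move: r_gt0; clearbody r; nra.
Qed.

(** A point of the trapezoid lies on the horizontal segment between the slanted
    and the vertical side, whose ends are convex combinations of vertices. *)
Lemma right_trapezoidE : right_trapezoid (pi / 3 : R) (1 / 8) = trapezoid.
Proof.
rewrite /right_trapezoid cos_pi3 sin_pi3 -/r; apply/seteqP; split.
  apply: smallest_sub; first exact: trapezoid_convex.
  move=> v /=; rewrite !inE => /or4P[] /eqP ->; rewrite /trapezoid /=;
    by split=> /=; have := r_gt0; clearbody r; lra.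
rewrite /trapezoid => -[x y] /= [y0 yr x58 yx] C [cC CV].
have V v : v \in [:: (0, 0); (1 / 2, r / 2); (1 / 8 + 1 / 2, r / 2);
    (1 / 8 + 1 / 2, 0)] -> C v by exact: CV.
have rn0 : r != 0 by rewrite gt_eqF.
pose t := 2 * y / r.
have t0 : 0 <= t by apply: divr_ge0; [lra|exact: ltW].
have t1 : t <= 1 by rewrite ler_pdivrMr //; lra.
have CL : C (y / r, y).
  have := @convex_set_combination _ (1 / 2, r / 2) (0, 0) t cC (V _ _) (V _ _) t0 t1.
  rewrite !inE !eqxx ?orbT /= => /(_ isT isT); congr C.
  by rewrite /t; congr pair; field.
have CR : C (5 / 8, y).
  have := @convex_set_combination _ (1 / 8 + 1 / 2, r / 2) (1 / 8 + 1 / 2, 0) t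
    cC (V _ _) (V _ _) t0 t1.
  rewrite !inE !eqxx ?orbT /= => /(_ isT isT); congr C.
  by rewrite /t; congr pair; field.
have yr2 : y / r <= 1 / 2 by rewrite ler_pdivrMr //; lra.
have xr : y / r <= x by rewrite ler_pdivrMr // mulrC.
have d0 : 0 < 5 / 8 - y / r by lra.
pose w := (x - y / r) / (5 / 8 - y / r).
have w0 : 0 <= w by apply: divr_ge0; lra.
have w1 : w <= 1 by rewrite ler_pdivrMr //; lra.
have := convex_set_combination _ _ _ _ cC CR CL w0 w1; congr C => /=; congr pair; last ring.
have dn : 5 / 8 - y / r != 0 by rewrite gt_eqF.
by rewrite -[RHS](subrK (y / r)) -[x - _](divfK dn) -/w; ring.
Qed.

(** The trapezoid is the convex hull of its vertices, and a half-plane is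
    convex. *)
Lemma trapezoid_affine_le0 a b e : e <= 0 -> a / 2 + b * (r / 2) + e <= 0 ->
  a * (5 / 8) + b * (r / 2) + e <= 0 -> a * (5 / 8) + e <= 0 ->
  forall p, trapezoid p -> a * p.1 + b * p.2 + e <= 0.
Proof.
move=> v1 v2 v3 v4; rewrite -right_trapezoidE.
apply: smallest_sub; first exact: half_plane_convex.
move=> v /=; rewrite cos_pi3 sin_pi3 -/r !inE.
by move=> /or4P[] /eqP -> /=; clearbody r; lra.
Qed.

Lemma open_trapezoid_sub : open_trapezoid `<=` trapezoid.
Proof. by move=> p [? ? ? ?]; split; exact: ltW. Qed.

Lemma trapezoid_half_planes : trapezoid =
  [set p | 0 * p.1 + (-1) * p.2 + 0 <= 0]
  `&` [set p | 0 * p.1 + 1 * p.2 + - (r / 2) <= 0]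
  `&` [set p | 1 * p.1 + 0 * p.2 + - (5 / 8) <= 0]
  `&` [set p | - r * p.1 + 1 * p.2 + 0 <= 0].
Proof.
apply/seteqP; split=> p.
  by move=> [? ? ? ?]; split; [split; [split|]|] => /=; lra.
by move=> [[[/= ? ?] ?] ?]; split; lra.
Qed.

Lemma open_trapezoid_half_planes : open_trapezoid =
  [set p | 0 * p.1 + (-1) * p.2 + 0 < 0]
  `&` [set p | 0 * p.1 + 1 * p.2 + - (r / 2) < 0]
  `&` [set p | 1 * p.1 + 0 * p.2 + - (5 / 8) < 0]
  `&` [set p | - r * p.1 + 1 * p.2 + 0 < 0].
Proof.
apply/seteqP; split=> p.
  by move=> [? ? ? ?]; split; [split; [split|]|] => /=; lra.
by move=> [[[/= ? ?] ?] ?]; split; lra.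
Qed.

Lemma half_plane_closed a b e : closed [set p : R * R | a * p.1 + b * p.2 + e <= 0].
Proof.
apply: (closed_comp (f := fun p : R * R => a * p.1 + b * p.2 + e) (D := [set x | x <= 0])).
  by move=> p _; exact: affine_form_continuous.
exact: closed_le.
Qed.

Lemma half_plane_open a b e : open [set p : R * R | a * p.1 + b * p.2 + e < 0].
Proof.
apply: (open_comp (f := fun p : R * R => a * p.1 + b * p.2 + e) (D := [set x | x < 0])).
  by move=> p _; exact: affine_form_continuous.
exact: open_lt.
Qed.

Lemma trapezoid_closed : closed trapezoid.
Proof.
by rewrite trapezoid_half_planes; do ?apply: closedI; exact: half_plane_closed.
Qed.

Lemma open_trapezoid_open : open open_trapezoid.
Proof.
by rewrite open_trapezoid_half_planes; do ?apply: openI; exact: half_plane_open.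
Qed.

End Trapezoid.

Arguments trapezoid {R}.
Arguments open_trapezoid {R}.

(** * Areas and interiors around the trapezoid *)

Section AreaOfTrapezoid.
Variable R : realType.
Implicit Types (p q : R * R).

Lemma half_plane_measurable (a b e : R) :
  measurable ([set p | a * p.1 + b * p.2 + e <= 0] : set (plane R)) /\
  measurable ([set p | a * p.1 + b * p.2 + e < 0] : set (plane R)).
Proof.
have m := @measurable_affine_form R a b e.
split; rewrite -[X in measurable X]setTI.
  rewrite (_ : mkset _ =
      (fun p : R * R => a * p.1 + b * p.2 + e) @^-1` [set` `]-oo, 0]]); last first.
    by apply/seteqP; split => p; rewrite /= in_itv.
  by apply: m => //; exact: measurable_itv.
rewrite (_ : mkset _ =
      (fun p : R * R => a * p.1 + b * p.2 + e) @^-1` [set` `]-oo, 0[]); last first.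
  by apply/seteqP; split => p; rewrite /= in_itv.
by apply: m => //; exact: measurable_itv.
Qed.

Lemma trapezoid_measurable :
  measurable (trapezoid : set (plane R)).
Proof.
rewrite trapezoid_half_planes; do ?apply: measurableI.
all: exact: (half_plane_measurable _ _ _).1.
Qed.

Lemma open_trapezoid_measurable :
  measurable (open_trapezoid : set (plane R)).
Proof.
rewrite open_trapezoid_half_planes; do ?apply: measurableI.
all: exact: (half_plane_measurable _ _ _).2.
Qed.

Lemma open_positive_area (U : set (R * R)) p : open U -> U p ->
  exists B : set (plane R),
    [/\ measurable B, B `<=` U & (0 < area B)%E].
Proof.
move=> oU Up; have /nbhs_ballP[e /= e0 sub] := open_nbhs_nbhs (conj oU Up).
pose D (x : R) : set (measurableTypeR R) := ball x e.
have mD x : measurable (D x) by exact: measurable_ball.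
have DE x : lebesgue_measure (D x) = (e *+ 2)%:E.
  exact: lebesgue_measure_ball (ltW e0).
exists (D p.1 `*` D p.2); split; first exact: measurableX.
  by move=> q [? ?]; exact: sub.
have -> : area (D p.1 `*` D p.2) = ((e *+ 2)%:E * (e *+ 2)%:E)%E.
  by rewrite -{1}(DE p.1) -(DE p.2); exact: product_measure1E.
rewrite -EFinM lte_fin.
by rewrite mulr_gt0 // pmulrn_lgt0.
Qed.

Lemma open_trapezoid_point : open_trapezoid (1 / 2 : R, Num.sqrt 3 / 4).
Proof.
have r0 : 0 < Num.sqrt 3 :> R by rewrite sqrtr_gt0.
by split=> /=; move: (Num.sqrt 3) r0 => r r0; lra.
Qed.

Lemma area_trapezoid_gt0 : (0 < area (trapezoid : set (R * R)))%E.
Proof.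
have [B [mB sB B0]] := open_positive_area _ _ (@open_trapezoid_open R) open_trapezoid_point.
apply: (lt_le_trans B0); apply: le_measure; rewrite ?inE //.
  exact: trapezoid_measurable.
by apply: (subset_trans sB); exact: open_trapezoid_sub.
Qed.

Lemma area_trapezoid_fin : (area (trapezoid : set (R * R)) < +oo)%E.
Proof.
have r0 : 0 < Num.sqrt 3 :> R by rewrite sqrtr_gt0.
pose Q : set (plane R) :=
  [set` `[0, 1]] `*` [set` `[0, Num.sqrt 3]].
have QE : area Q = (1%:E * (Num.sqrt 3)%:E)%E.
  have m01 : measurable ([set` `[0, 1]] : set (measurableTypeR R)).
    exact: measurable_itv.
  have m03 : measurable ([set` `[0, Num.sqrt 3]] : set (measurableTypeR R)).
    exact: measurable_itv.
  have L x : 0 < x -> lebesgue_measure ([set` `[0, x]] : set (measurableTypeR R)) = x%:E.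
    by move=> x0; rewrite lebesgue_measure_itv /= lte_fin x0 -EFinD subr0.
  by rewrite -{1}(L 1) // -(L (Num.sqrt 3)) //; exact: product_measure1E.
apply: (@le_lt_trans _ _ (area Q)).
  apply: le_measure; rewrite ?inE.
  - exact: trapezoid_measurable.
  - by apply: measurableX; exact: measurable_itv.
  - move=> p [p1 p2 p3 p4]; split; rewrite /= in_itv /=; apply/andP; split;
    move: (Num.sqrt 3) r0 p1 p2 p3 p4 => r r0 p1 p2 p3 p4; nra.
by rewrite QE -EFinM ltry.
Qed.

Lemma interior_segment (S : set (R * R)) p (d1 d2 : R) : interior S p ->
  exists2 t, 0 < t <= 1 & S (p.1 + t * d1, p.2 + t * d2).
Proof.
move=> /nbhs_ballP[e /= e0 sub].
pose m := `|d1| + `|d2| + 1.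
have n1 : 0 <= `|d1| by []. have n2 : 0 <= `|d2| by [].
have m0 : 0 < m by rewrite /m; lra.
have me0 : 0 < m + e by lra.
have t0 : 0 < e / (m + e) by rewrite divr_gt0.
exists (e / (m + e)).
  by rewrite t0 ler_pdivrMr //; lra.
apply: sub.
have H d : `|d| <= m -> `|e / (m + e) * d| < e.
  move=> dm; rewrite normrM gtr0_norm //.
  apply: (@le_lt_trans _ _ (e / (m + e) * m)); first by rewrite ler_pM2l.
  by rewrite mulrAC ltr_pdivrMr // ltr_pM2l //; lra.
split; rewrite /= /ball /= opprD addrA subrr add0r normrN; apply: H; rewrite /m; lra.
Qed.

(** From an interior point one can move a little in the direction (a, b), along
    which the form increases. *)
Lemma interior_half_plane (S : set (R * R)) (a b e : R) p :
  (a != 0) || (b != 0) -> (forall q, S q -> a * q.1 + b * q.2 + e <= 0) ->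
  interior S p -> a * p.1 + b * p.2 + e < 0.
Proof.
move=> ab hS /(interior_segment _ _ a b)[t /andP[t0 _] /hS /= h].
have d0 : 0 < a ^+ 2 + b ^+ 2.
  by rewrite lt_neqAle eq_sym paddr_eq0 ?sqr_ge0 // !sqrf_eq0 negb_and ab addr_ge0 ?sqr_ge0.
have : 0 < t * (a ^+ 2 + b ^+ 2) by exact: mulr_gt0.
lra.
Qed.

Lemma interior_trapezoid : interior trapezoid `<=` (open_trapezoid : set (R * R)).
Proof.
have r0 : 0 < Num.sqrt 3 :> R by rewrite sqrtr_gt0.
move=> p ip.
have H a b e ab h := @interior_half_plane trapezoid a b e p ab h ip.
split.
- suff: 0 * p.1 + (-1) * p.2 + 0 < 0 by lra.
  by apply: H => [|q [? ? ? ?]]; [rewrite oppr_eq0 oner_eq0 orbT|lra].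
- suff: 0 * p.1 + 1 * p.2 + - (Num.sqrt 3 / 2) < 0 by lra.
  by apply: H => [|q [? ? ? ?]]; [rewrite oner_eq0 orbT|lra].
- suff: 1 * p.1 + 0 * p.2 + - (5 / 8) < 0 by lra.
  by apply: H => [|q [? ? ? ?]]; [rewrite oner_eq0|lra].
- suff: - Num.sqrt 3 * p.1 + 1 * p.2 + 0 < 0 by lra.
  by apply: H => [|q [? ? ? ?]]; [rewrite oner_eq0 orbT|lra].
Qed.

End AreaOfTrapezoid.

(** * There is no dissection into fewer than 25 tiles *)

Section NoSmallDissection.
Variable R : realType.
Implicit Types (p q : R * R).
Let r : R := Num.sqrt 3.
Let r_gt0 : 0 < r. Proof. by rewrite sqrtr_gt0. Qed.
Let r_sq : r ^+ 2 = 3. Proof. by rewrite sqr_sqrtr. Qed.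

(** Compare areas: n tiles of area c^2 times the area of the trapezoid cover
    it. *)
Lemma cover_count n (c : R) (f : 'I_n -> R * R -> R * R) : 0 < c ->
  (forall i, similarity c (f i)) ->
  trapezoid `<=` \bigcup_(i in [set: 'I_n]) f i @` trapezoid -> 1 <= n%:R * c ^+ 2.
Proof.
move=> c0 fc cov.
pose F k : set (plane R) :=
  if insub k is Some i then f i @` trapezoid else set0.
have FE (i : 'I_n) : F i = f i @` trapezoid by rewrite /F valK.
have M (i : 'I_n) := similarity_area _ _ _ c0 (fc i) _ (@trapezoid_measurable R).
have a0 := @area_trapezoid_gt0 R; have afin := @area_trapezoid_fin R.
have aE : area (trapezoid : set (R * R)) = (fine (area (trapezoid : set (R * R))))%:E.
  by rewrite fineK // ge0_fin_numE // ltW.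
set al := fine _ in aE; have al0 : 0 < al by rewrite -lte_fin -aE.
have : (area trapezoid <= \sum_(k < n) area (F k))%E.
  apply: content_subadditive.
  - move=> k _; rewrite /F; case: insubP => [i _ _|_]; [exact: (M i).1|exact: measurable0].
  - exact: trapezoid_measurable.
  - move=> p /cov[i _ fip]; rewrite -bigcup_mkord; exists i => //=; by rewrite FE.
under eq_bigr => i _ do rewrite FE (M i).2 aE -EFinM.
rewrite sumEFin aE lee_fin sumr_const card_ord => h.
by rewrite -(ler_pM2r al0) mul1r -mulrA mulr_natl.
Qed.

Lemma trapezoid_vertices : [/\ trapezoid (0 : R, 0 : R), trapezoid (1 / 2, r / 2),
  trapezoid (5 / 8, r / 2) & trapezoid (5 / 8 : R, 0 : R)].
Proof.
have r0 : 0 < r by [].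
by split; split=> /=; rewrite -/r; clearbody r; lra.
Qed.

(** A linear form that attains its maximum over the trapezoid at two points is
    constant along a side, so its gradient is normal to one of the four sides; in
    every other direction the maximum is attained at a single vertex. *)
Lemma trapezoid_support (a b m : R) p q :
  (forall x, trapezoid x -> a * x.1 + b * x.2 <= m) ->
  trapezoid p -> trapezoid q -> a * p.1 + b * p.2 = m -> a * q.1 + b * q.2 = m ->
  p <> q -> a != 0 \/ b != 0 ->
  [\/ a = 0 /\ 0 < b, a = 0 /\ b < 0, 0 < a /\ b = 0 | a = - (r * b) /\ 0 < b].
Proof.
have r0 : 0 < r by [].
move=> le_m Tp Tq pm qm pq ab.
have [T1 T2 T3 T4] := trapezoid_vertices.
have V1 : 0 <= m.
  by have := le_m _ T1; rewrite /= !mulr0 addr0.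
have V2 : a / 2 + b * (r / 2) <= m.
  by have := le_m _ T2; rewrite /= mul1r.
have V3 : a * (5 / 8) + b * (r / 2) <= m.
  exact: le_m _ T3.
have V4 : a * (5 / 8) <= m.
  by have := le_m _ T4; rewrite /= mulr0 addr0.
have uniq v : (forall x, trapezoid x -> a * x.1 + b * x.2 = m -> x = v) -> False.
  by move=> H; apply: pq; rewrite (H p) // (H q).
have pt x y (z : R * R) : z.1 = x -> z.2 = y -> z = (x, y).
  by case: z => ? ? /= -> ->.
clear T1 T2 T3 T4 le_m Tp Tq pm qm pq.
case: (ltgtP a 0) => a0.
- case: (lerP b 0) => b0.
    exfalso; apply: (uniq (0, 0)) => x [x1 x2 x3 x4] xm.
    rewrite -/r in x2 x4; clearbody r.
    have y0 : 0 <= x.1 by nra.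
    have y1 : x.1 = 0 by nra.
    by apply: pt => //; nra.
  case: (ltgtP (a + r * b) 0) => k0.
  - exfalso; apply: (uniq (0, 0)) => x [x1 x2 x3 x4] xm.
    rewrite -/r in x2 x4; clearbody r.
    have rm : 0 <= r * m by rewrite mulr_ge0 // ltW.
    have h : r * (a * x.1) <= a * x.2 by nra.
    have y2 : x.2 = 0 by nra.
    by apply: pt => //; nra.
  - exfalso; apply: (uniq (1 / 2, r / 2)) => x [x1 x2 x3 x4] xm.
    rewrite -/r in x2 x4; clearbody r.
    have rm : r * ((a + r * b) / 2) <= r * m by rewrite ler_pM2l //; lra.
    have h : r * (a * x.1) <= a * x.2 by nra.
    have y2 : x.2 = r / 2 by nra.
    apply: pt => //; rewrite y2 in xm x4.
    have : r * (1 / 2) <= r * x.1 by lra.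
    rewrite ler_pM2l // => h1; nra.
  - by apply: Or44; split=> //; lra.
- case: (ltgtP b 0) => b0; last by apply: Or43.
    exfalso; apply: (uniq (5 / 8, 0)) => x [x1 x2 x3 x4] xm.
    by clearbody r; apply: pt; nra.
  exfalso; apply: (uniq (5 / 8, r / 2)) => x [x1 x2 x3 x4] xm.
  by rewrite -/r in x2 x4; clearbody r; apply: pt; nra.
- case: (ltgtP b 0) => b0; [exact: Or42|exact: Or41|].
  by case: ab; rewrite ?a0 ?b0 eqxx.
Qed.

(** The top base has length 1/8, which bounds the distance of the images. *)
Lemma short_top_image (c : R) (f : R * R -> R * R) p q : similarity c f ->
  f @` trapezoid `<=` trapezoid -> trapezoid p -> trapezoid q ->
  (f p).2 = r / 2 -> (f q).2 = r / 2 ->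
  c ^+ 2 * ((p.1 - q.1) ^+ 2 + (p.2 - q.2) ^+ 2) <= 1 / 64.
Proof.
have r0 : 0 < r by [].
move=> fc fT Tp Tq fp2 fq2.
have top x : trapezoid x -> (f x).2 = r / 2 -> 1 / 2 <= (f x).1 <= 5 / 8.
  move=> Tx fx2; have [_ _ x3 x4] : trapezoid (f x) by apply: fT; exists x.
  rewrite x3 andbT; rewrite -/r fx2 in x4.
  by rewrite -(ler_pM2l r0); lra.
rewrite -edist_sq -exprMn -fc edist_sq fp2 fq2 subrr expr0n addr0.
have /andP[a1 a2] := top p Tp fp2; have /andP[b1 b2] := top q Tq fq2.
nra.
Qed.

(** The ordinate of f is a linear form on the tile, maximal at two points, hence
    along a side.  That side lies on the top base; it can only be the short base
    of the tile, since the three others have length at least 5 c / 8 > 1/8. *)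
Lemma top_tile (c : R) (f : R * R -> R * R) P Q : 1 / 5 < c ->
  similarity c f -> f @` trapezoid `<=` trapezoid ->
  (f @` trapezoid) P -> (f @` trapezoid) Q -> P <> Q ->
  P.2 = r / 2 -> Q.2 = r / 2 ->
  exists s e : R, (s = 1 \/ s = -1) /\
    f = fun x => (s * (c * x.1) + e, r / 2 - c * (r / 2 - x.2)).
Proof.
have r0 : 0 < r by [].
move=> c5 fc fT [p Tp <-] [q Tq <-] PQ p2 q2.
have c0 : 0 < c by lra.
have c25 : 1 / 25 < c ^+ 2 by nra.
have short := short_top_image _ _ _ _ fc fT.
have [u [v [s [e [h [uv s2 fE]]]]]] := similarity_affine _ _ _ c0 fc.
have f2 x : (f x).2 = v * x.1 + s * u * x.2 + h by rewrite fE.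
have pq : p <> q by move=> E; apply: PQ; rewrite E.
have [T1 T2 T3 T4] := trapezoid_vertices.
have le_m x : trapezoid x -> v * x.1 + s * u * x.2 <= r / 2 - h.
  move=> Tx; have [_ + _ _] : trapezoid (f x) by apply: fT; exists x.
  by rewrite f2 -/r; lra.
have pm : v * p.1 + s * u * p.2 = r / 2 - h by rewrite -p2 f2; ring.
have qm : v * q.1 + s * u * q.2 = r / 2 - h by rewrite -q2 f2; ring.
have s0 : s = 1 \/ s = -1.
  by move/eqP: s2; rewrite sqrf_eq1 => /orP[] /eqP; [left|right].
have vsu : v != 0 \/ s * u != 0.
  have [v0|] := eqVneq v 0; [right|by left].
  apply/eqP => su0.
  have u0 : u = 0 by rewrite -[u]mul1r -s2 expr2 -mulrA su0 mulr0.
  have : c ^+ 2 = 0 by rewrite -uv v0 u0 expr0n addr0.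
  by move: c25; lra.
have p2' : p.2 <= r / 2 by case: Tp.
have le1 := le_m _ T1; have le2 := le_m _ T2; have le3 := le_m _ T3; have le4 := le_m _ T4.
rewrite /= in le1 le2 le3 le4.
have [[v0 su]|[v0 su]|[v0 su]|[v0 su]] :=
  trapezoid_support _ _ _ _ _ le_m Tp Tq pm qm pq vsu.
- have suc : s * u = c.
    have h1 : (s * u) ^+ 2 = c ^+ 2 by rewrite exprMn s2 mul1r -uv v0 expr0n addr0.
    by apply/eqP; rewrite -(@eqrXn2 _ 2) ?h1 // ltW.
  exists s, e; split=> //; rewrite fE; apply/funext => x; rewrite /affine_map.
  have uE : u = s * c by rewrite -suc mulrA -expr2 s2 mul1r.
  have hE : h = r / 2 - c * (r / 2).
    rewrite suc v0 in pm le3.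
    have : c * p.2 <= c * (r / 2) by rewrite ler_pM2l.
    lra.
  rewrite suc hE v0 uE; congr pair; ring.
(* The long base of the tile on the top line. *)
- have p20 : 0 <= p.2 by case: Tp.
  have m0 : r / 2 - h = 0.
    have : s * u * p.2 <= 0 by rewrite nmulr_rle0.
    by rewrite v0 in pm; lra.
  have := short (0, 0) (5 / 8, 0) T1 T4.
  by rewrite !f2 /= v0 => /(_ _ _); nra.
(* The vertical side of the tile on the top line. *)
- have p1 : p.1 <= 5 / 8 by case: Tp.
  have m0 : r / 2 - h = v * (5 / 8).
    have : v * p.1 <= v * (5 / 8) by rewrite ler_pM2l.
    by rewrite su in pm; lra.
  have r2 := r_sq.
  have := short (5 / 8, r / 2) (5 / 8, 0) T3 T4.
  rewrite !f2 /= su.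
  have -> : c ^+ 2 * ((5 / 8 - 5 / 8) ^+ 2 + (r / 2 - 0) ^+ 2) = c ^+ 2 * (3 / 4).
    by rewrite -r2; field.
  by move=> /(_ _ _); lra.
(* The slanted side of the tile on the top line. *)
- have p4 : p.2 <= r * p.1 by case: Tp.
  have m0 : r / 2 - h = 0.
    have : s * u * p.2 <= s * u * (r * p.1) by rewrite ler_pM2l.
    by rewrite v0 in pm; lra.
  have r2 := r_sq.
  have := short (0, 0) (1 / 2, r / 2) T1 T2.
  rewrite !f2 /= v0.
  have -> : c ^+ 2 * ((0 - 1 / 2) ^+ 2 + (0 - r / 2) ^+ 2) = c ^+ 2.
    by rewrite -[X in _ = X]mulr1; congr (_ * _); move: r2; rewrite expr2; lra.
  by move=> /(_ _ _); lra.
Qed.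

(** Among n + 1 points of the window, two belong to the same of the n tiles. *)
Lemma top_window n (P : 'I_n -> set (R * R)) (lo hi : R) :
  trapezoid `<=` \bigcup_(i in [set: 'I_n]) P i ->
  1 / 2 <= lo -> lo < hi -> hi <= 5 / 8 ->
  exists i x y, [/\ lo < x < hi, lo < y < hi, x != y & P i (x, r / 2) /\ P i (y, r / 2)].
Proof.
have r0 : 0 < r by [].
move=> cov lo2 lohi hi8.
pose t (k : 'I_n.+1) : R := lo + (hi - lo) * (k.+1%:R / n.+2%:R).
have n20 : 0 < n.+2%:R :> R by rewrite ltr0n.
have tk k : lo < t k < hi.
  have a0 : 0 < k.+1%:R / n.+2%:R :> R by rewrite divr_gt0 ?ltr0n.
  have a1 : k.+1%:R / n.+2%:R < 1 :> R by rewrite ltr_pdivrMr // mul1r ltr_nat ltnS ltn_ord.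
  rewrite /t; move: (k.+1%:R / n.+2%:R) a0 a1 => w a0 a1.
  by apply/andP; split; nra.
have t_inj : injective t.
  move=> k l /addrI /mulfI H; apply/val_inj/eqP.
  have := H _; rewrite subr_eq0 gt_eqF // => /(_ isT) /(mulIf _) H2.
  have := H2 _; rewrite invr_eq0 gt_eqF // => /(_ isT) /eqP.
  by rewrite eqr_nat eqSS.
have /choice[g gP] : forall k, exists i, P i (t k, r / 2).
  move=> k; have [] // := cov (t k, r / 2).
    have /andP[? ?] := tk k; split=> /=; rewrite -/r; clearbody r; nra.
  by move=> i _ ?; exists i.
have : ~~ injectiveb g.
  apply/negP => /injectiveP /leq_card; by rewrite !card_ord ltnn.
move=> /injectivePn[k [l kl gkl]].
exists (g k), (t k), (t l); split=> //; last by split; [|rewrite gkl]; exact: gP.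
by apply: contra kl => /eqP /t_inj ->.
Qed.

(** The image of the open trapezoid is open, and contained in the tile. *)
Lemma similarity_interior (c : R) (f : R * R -> R * R) (p : R * R) : 0 < c ->
  similarity c f -> open_trapezoid p -> interior (f @` trapezoid) (f p).
Proof.
move=> c0 fc Op.
have oF := similarity_open _ _ _ c0 fc _ (@open_trapezoid_open R).
apply: (@filterS _ (nbhs (f p)) _ (f @` open_trapezoid)).
  exact: image_subset (@open_trapezoid_sub R).
by apply: open_nbhs_nbhs; split=> //; exists p.
Qed.

Lemma similarity_comp (c d : R) (f g : R * R -> R * R) :
  similarity c f -> similarity d g -> similarity (d * c) (g \o f).
Proof. by move=> fc gd p q; rewrite /= gd fc mulrA. Qed.

Lemma common_ratio n (P : 'I_n -> set (R * R)) (i0 : 'I_n) :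
  (forall i, Defs.similar trapezoid (P i)) -> (forall i j, congruent (P i) (P j)) ->
  exists c (f : 'I_n -> R * R -> R * R), 0 < c /\
    forall i, similarity c (f i) /\ P i = f i @` trapezoid.
Proof.
move=> sim cong; have [c [f0 [c0 f0c P0]]] := sim i0.
have /choice[f fP] : forall i, exists f, similarity c f /\ P i = f @` trapezoid.
  move=> i; have [g g1 ->] := cong i0 i; exists (g \o f0).
  split; last by rewrite P0 image_comp.
  by rewrite -[c]mul1r; exact: similarity_comp.
by exists c, f.
Qed.

Section Contradiction.
Variables (n : nat) (c : R) (f : 'I_n -> R * R -> R * R).
Hypotheses (c_gt : 1 / 5 < c) (fc : forall i, similarity c (f i)).
Hypothesis covers : \bigcup_(i in [set: 'I_n]) f i @` trapezoid = trapezoid.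
Hypothesis disjoint :
  trivIset [set: 'I_n] (fun i => interior (f i @` trapezoid)).

Let c_gt0 : 0 < c. Proof. by move: c_gt; lra. Qed.

Let f_sub i : f i @` trapezoid `<=` trapezoid.
Proof. by move=> p fp; rewrite -covers; exists i. Qed.

Let same_tile i j p q : open_trapezoid p -> open_trapezoid q ->
  f i p = f j q -> i = j.
Proof.
move=> Op Oq E; apply: disjoint => //; exists (f i p); split.
  exact: similarity_interior _ _ _ c_gt0 (fc i) Op.
by rewrite E; exact: similarity_interior _ _ _ c_gt0 (fc j) Oq.
Qed.

(** The sign s tells whether the tile is reflected; multiplying by s puts the
    short base of the tile, which is the interval from c / 2 to 5 c / 8 before it
    is reflected and translated, in increasing order in both cases. *)
Lemma window_tile lo hi : 1 / 2 <= lo -> lo < hi -> hi <= 5 / 8 ->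
  exists i s e, [/\ s = 1 \/ s = -1,
    f i = fun x => (s * (c * x.1) + e, r / 2 - c * (r / 2 - x.2)) &
    exists2 x, lo < x < hi & (s * e + c / 2 <= s * x <= s * e + c * (5 / 8))].
Proof.
have r0 : 0 < r by [].
move=> h1 h2 h3.
have cov : trapezoid `<=` \bigcup_(i in [set: 'I_n]) f i @` trapezoid.
  by rewrite covers.
have [i [x [y [hx hy xy [Px Py]]]]] := top_window _ _ _ _ cov h1 h2 h3.
have xy' : (x, r / 2) <> (y, r / 2) by case=> E; rewrite E eqxx in xy.
have [s [e [s1 fE]]] := top_tile _ _ _ _ c_gt (fc i) (@f_sub i) Px Py xy' erefl erefl.
exists i, s, e; split=> //; exists x => //.
case: Px => p [_ p2 p3 p4]; rewrite fE => -[<- E2].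
have p2E : p.2 = r / 2.
  by apply/eqP; rewrite -subr_eq0 -(mulrI_eq0 _ (mulfI (lt0r_neq0 c_gt0))); apply/eqP; lra.
rewrite -/r p2E in p4.
have h : 1 / 2 <= p.1 by rewrite -(ler_pM2l r0); lra.
have a1 : c * (1 / 2) <= c * p.1 by rewrite ler_pM2l.
have a2 : c * p.1 <= c * (5 / 8) by rewrite ler_pM2l.
have ss : s * (s * (c * p.1) + e) = c * p.1 + s * e by case: s1 => ->; ring.
by rewrite ss; apply/andP; split; lra.
Qed.

(** The vertex of angle 60 degrees of a reflected tile is c / 2 further to the
    right than its short base, so a reflected tile this close to the corner would
    cross the vertical side. *)
Lemma corner_tile d : 0 < d -> d <= 1 / 8 -> d <= c / 16 -> exists i e,
  [/\ f i = fun x => (c * x.1 + e, r / 2 - c * (r / 2 - x.2)),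
      e + c * (5 / 8) <= 5 / 8 & 5 / 8 - d < e + c * (5 / 8)].
Proof.
have r0 : 0 < r by [].
move=> d0 d8 dc.
have [||//|i [s [e [s1 fE [x /andP[x1 x2] /andP[x3 x4]]]]]] :=
  window_tile (5 / 8 - d) (5 / 8); try lra.
have [T1 _ _ T4] := trapezoid_vertices.
case: s1 => s1; rewrite {s}s1 in fE x3 x4.
  exists i, e; split; last lra.
    by rewrite fE; apply/funext => z; rewrite mul1r.
  have [] : trapezoid (f i (5 / 8, 0)) by apply: f_sub; exists (5 / 8, 0).
  by rewrite fE /=; lra.
have [_ _ + _] : trapezoid (f i (0, 0)) by apply: f_sub; exists (0, 0).
by rewrite fE /=; have := c_gt0; lra.
Qed.

(** The corner tile is not higher than the trapezoid, so c <= 1; if c = 1 it is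
    the whole trapezoid and overlaps every other tile. *)
Lemma ratio_lt1 : (1 < n)%N -> c < 1.
Proof.
have r0 : 0 < r by [].
move=> n1.
(* At most 1/8 and c / 16 at once, whatever the size of c. *)
pose d := c / (16 * (1 + c)).
have c0 := c_gt0.
have dE : d * (16 * (1 + c)) = c by rewrite divfK // gt_eqF //; lra.
have d0 : 0 < d by rewrite divr_gt0 //; lra.
have [||i [e [fE e1 e2]]] := corner_tile d d0; [nra|nra|].
have [T1 _ _ _] := trapezoid_vertices.
have [+ _ _ +] : trapezoid (f i (0, 0)) by apply: f_sub; exists (0, 0).
rewrite fE -/r /= => h1 h2.
have c1 : c <= 1.
  have : 0 <= r * (1 - c) by lra.
  by rewrite pmulr_rge0 //; lra.
rewrite lt_neqAle c1 andbT; apply/eqP => cE.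
have e0 : 0 <= e.
  have : 0 <= r * e by rewrite cE in h2; lra.
  by rewrite pmulr_rge0.
have eE : e = 0 by rewrite cE in e1; lra.
have fid : f i = id.
  by rewrite fE; apply/funext => -[x y] /=; rewrite cE eE; congr pair; ring.
have [j ji] : exists j, j != i.
  have lt0 : (0 < n)%N by exact: ltnW.
  have [->|] := eqVneq i (Ordinal lt0); last by rewrite eq_sym; exists (Ordinal lt0).
  by exists (Ordinal n1).
move/eqP: ji; apply; apply: disjoint => //.
exists (f j (1 / 2, r / 4)).
have Ij := similarity_interior _ _ _ c_gt0 (fc j) (@open_trapezoid_point R).
split; first exact: Ij.
apply: (filterS _ Ij); rewrite fid image_id; exact: f_sub.
Qed.

(** The corner tile i has its short base from e + c / 2 to e + 5 c / 8, and a
    second tile j contains top points in a window of length d just to the left of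
    it.  On the horizontal line that corresponds to y = r / 8 in the standard
    position, the interior of a tile extends over c / 8 < z < 5 c / 8, where z is
    the distance to its abscissa e; there the two tiles have a point in common,
    for both orientations of j.  So i = j, although the tile i has no top point in
    the window. *)
Lemma no_dissection : (1 < n)%N -> False.
Proof.
have r0 : 0 < r by [].
have c0 := c_gt0.
move=> n1; have c1 := ratio_lt1 n1.
(* Below both c / 16 and (1 - c) / 16. *)
pose d := c * (1 - c) / 16.
have d0 : 0 < d by rewrite /d; nra.
have dc : d <= c / 16 by rewrite /d; nra.
have d1 : d <= (1 - c) / 16 by rewrite /d; nra.
have [||i [e [fE e1 e2]]] := corner_tile d d0; [lra|lra|].
have [|||j [s [e' [s1 fjE [x /andP[x1 x2] /andP[x3 x4]]]]]] :=
  window_tile (e + c / 2 - d) (e + c / 2); [lra|lra|lra|].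
have cn0 : c != 0 by rewrite gt_eqF.
have inside z : c / 8 < z -> z < c * (5 / 8) -> open_trapezoid (z / c, r / 8).
  move=> z1 z2.
  have w1 : 1 / 8 < z / c by rewrite ltr_pdivlMr //; lra.
  have w2 : z / c < 5 / 8 by rewrite ltr_pdivrMr //; lra.
  split=> /=; rewrite -/r; [lra|lra|by []|].
  have : r * (1 / 8) < r * (z / c) by rewrite ltr_pM2l.
  lra.
have val z : c * (z / c) = z by rewrite mulrC divfK.
(* The common point is at z = 3 c / 16 or z = 9 c / 16 in the tile i, according
   to the orientation of j. *)
have ij : i = j.
  case: s1 => s1; rewrite {s}s1 in fjE x3 x4.
    apply: (same_tile i j (3 / 16 * c / c, r / 8) ((3 / 16 * c + e - e') / c, r / 8)).
    - by apply: inside; lra.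
    - by apply: inside; lra.
    - by rewrite fE fjE /= !val; congr pair; lra.
  apply: (same_tile i j (9 / 16 * c / c, r / 8) ((e' - (9 / 16 * c + e)) / c, r / 8)).
  - by apply: inside; lra.
  - by apply: inside; lra.
  - by rewrite fE fjE /= !val; congr pair; lra.
have E1 : (f i (1, 0)).1 = (f j (1, 0)).1 by rewrite ij.
have E2 : (f i (0, 0)).1 = (f j (0, 0)).1 by rewrite ij.
move: E1 E2; rewrite fE fjE /=.
by case: s1 => s1; rewrite {s}s1 in fjE x3 x4 *; lra.
Qed.

End Contradiction.

Theorem not_rep_trapezoid n : (1 < n < 25)%N -> ~ rep n (trapezoid : set (R * R)).
Proof.
move=> /andP[n1 n25] [P [[cov disj] sim cong]].
have [c [f [c0 fP]]] := common_ratio _ _ (Ordinal (ltnW n1)) sim cong.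
have fc i := (fP i).1.
have PE : P = fun i => f i @` trapezoid by apply/funext => i; exact: (fP i).2.
rewrite PE in cov disj.
have : 1 <= n%:R * c ^+ 2.
  by apply: (cover_count _ _ f) => //; rewrite cov.
have n24 : n%:R <= 24 :> R by rewrite ler_nat.
move=> h; apply: (no_dissection n c f) => //.
have c2 : 1 <= 24 * c ^+ 2.
  by apply: (le_trans h); rewrite ler_wpM2r // sqr_ge0.
nra.
Qed.
End NoSmallDissection.

(** * Disjoint tiles of the right total area fill the trapezoid *)

Section Filling.
Variable R : realType.
Implicit Types (p q : R * R).

(** A point outside the closed union W of the tiles can be moved, towards an
    interior point q of the trapezoid, to a point of the open trapezoid still
    outside W.  Some set B of positive area around it avoids all the tiles.  But
    the open trapezoid contains B together with the disjoint interiors of the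
    tiles, whose areas already add up to its own. *)
Lemma area_filling n (c : R) (f : 'I_n -> R * R -> R * R) : 0 < c ->
  (forall i, similarity c (f i)) -> 1 <= n%:R * c ^+ 2 ->
  (forall i, f i @` trapezoid `<=` trapezoid) ->
  trivIset [set: 'I_n] (fun i => interior (f i @` trapezoid)) ->
  trapezoid `<=` \bigcup_(i in [set: 'I_n]) f i @` trapezoid.
Proof.
move=> c0 fc nc sub disj p Tp; apply: contrapT => np.
set W := \bigcup_(i in _) _ in np.
have cW : closed W.
  apply: closed_bigcup => [|i _]; first exact: finite_finset.
  by apply: (similarity_closed _ _ _ c0 (fc i)); exact: trapezoid_closed.
have oW : open (~` W) by exact: closed_openC.
pose q : R * R := (1 / 2, Num.sqrt 3 / 4).
have Oq : open_trapezoid q by exact: open_trapezoid_point.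
have ip : interior (~` W) p by exact: (open_nbhs_nbhs (conj oW np)).
have [t /andP[t0 t1] Wt] := interior_segment _ _ _ (q.1 - p.1) (q.2 - p.2) ip.
set x := (_, _) in Wt.
have Ox : open_trapezoid x.
  case: Tp Oq => p1 p2 p3 p4 [q1 q2 q3 q4]; split; rewrite /x /=;
  move: (q.1) (q.2) q1 q2 q3 q4 => y z q1 q2 q3 q4;
  move: (Num.sqrt 3) p1 p2 p3 p4 q1 q2 q3 q4 => r p1 p2 p3 p4 q1 q2 q3 q4; nra.
have [B [mB BU B0]] := open_positive_area _ _ _
  (openI (@open_trapezoid_open R) oW) (conj Ox Wt).
have mO := @open_trapezoid_measurable R.
pose G i : set (plane R) := f i @` open_trapezoid.
have M i := similarity_area _ _ _ c0 (fc i) _ mO.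
have Gint i : G i `<=` interior (f i @` trapezoid).
  by move=> _ [z Oz <-]; exact: similarity_interior _ _ _ _ c0 (fc i) Oz.
pose V := \big[setU/set0]_(i < n) G i.
have mV : measurable V by apply: bigsetU_measurable => i _; exact: (M i).1.
have VW : V `<=` open_trapezoid `&` W.
  apply: (big_ind (fun A : set (R * R) => A `<=` open_trapezoid `&` W)) => //.
    by move=> A A' hA hA' z [/hA|/hA'].
  move=> i _ z Gz; have iz := Gint i z Gz; split.
    by apply: interior_trapezoid; apply: filterS iz; exact: sub.
  by exists i => //; exact: interior_subset.
have VB : V `&` B = set0.
  by rewrite -subset0 => z [/VW[_ Wz] /BU[_]].
have aV : area V = (\sum_(i < n) area (G i))%E.
  apply: measure_bigsetU_ord => [i|]; first exact: (M i).1.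
  move=> i j _ _ [z [zi zj]]; apply: disj => //.
  by exists z; split; exact: Gint.
have le_al : (area V + area B <= area (open_trapezoid : set (R * R)))%E.
  rewrite -(measureU area mV mB VB); apply: le_measure; rewrite ?inE //.
    exact: measurableU.
  by move=> z [/VW[]|/BU[]].
have fin : (area (open_trapezoid : set (R * R)) < +oo)%E.
  apply: le_lt_trans (@area_trapezoid_fin R); apply: le_measure; rewrite ?inE //.
    exact: trapezoid_measurable.
  exact: open_trapezoid_sub.
have aE : area (open_trapezoid : set (R * R))
    = (fine (area (open_trapezoid : set (R * R))))%:E.
  by rewrite fineK // ge0_fin_numE.
move: le_al; rewrite aV; under eq_bigr => i _ do rewrite (M i).2 aE -EFinM.
set al := fine _ in aE *; have al0 : 0 <= al by rewrite -lee_fin -aE.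
rewrite sumEFin sumr_const card_ord aE => le_al.
have Bfin : area B \is a fin_num.
  rewrite ge0_fin_numE //; apply: le_lt_trans (ltry al).
  by apply: le_trans le_al; rewrite leeDr // lee_fin mulrn_wge0 // mulr_ge0 // sqr_ge0.
move: le_al B0; rewrite -(fineK Bfin) -EFinD lee_fin lte_fin.
rewrite -[X in X + _]mulr_natl mulrA => h1 h2.
have := ler_wpM2r al0 nc; lra.
Qed.
End Filling.

(** * A dissection into 25 tiles *)

(** The trapezoid reduced to one fifth, reflected in a vertical line if the third
    component is -1, then turned by the multiple of 60 degrees whose cosine and
    sine are half the first component and r/2 times the second one, then
    translated.  The last two components give the position of the vertex of angle
    60 degrees in the coordinates 80 x and 80 y / r. *)
Record placement := Placement
  { pcos : int; psin : int; pflip : int; pabs : int; pord : int }.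

Definition vertex (t : placement) (ab : int * int) : int * int :=
  (pcos t * pflip t * ab.1 - 3 * psin t * ab.2 + pabs t,
   psin t * pflip t * ab.1 + pcos t * ab.2 + pord t).

(** In these coordinates the tile before it is placed has the vertices 2 (a, b)
    for the pairs (a, b) below; the factor 2 cancels the halves in the cosine and
    the sine. *)
Definition vertices (t : placement) : seq (int * int) :=
  [seq vertex t ab | ab <- [:: (0, 0); (4, 4); (5, 4); (5, 0)]].

Definition form (d v : int * int) : int := d.1 * v.1 + d.2 * v.2.

(** In the integer coordinates, the normals, with both signs, of the lines whose
    angle with the horizontal is a multiple of 30 degrees; every side of a tile
    is on such a line. *)
Definition directions : seq (int * int) :=
  [:: (0, 1); (0, -1); (1, 1); (-1, -1); (1, -1); (-1, 1);
      (1, 0); (-1, 0); (1, 3); (-1, -3); (1, -3); (-1, 3)].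

Definition separated_along (t t' : placement) (d : int * int) : bool :=
  has (fun v0 => all (fun v => form d v <= form d v0) (vertices t)
              && all (fun v => form d v0 <= form d v) (vertices t')) (vertices t).

Definition separated (t t' : placement) : bool :=
  has (separated_along t t') directions.

(** The inequalities on v say that a vertex lies in the big trapezoid. *)
Definition well_placed (t : placement) : bool :=
  [&& pcos t ^+ 2 + 3 * psin t ^+ 2 == 4, pflip t ^+ 2 == 1 &
    all (fun v => [&& 0 <= v.2, v.2 <= 40, v.1 <= 50 & v.2 <= v.1]) (vertices t)].

Definition tiling : seq placement :=
  [:: Placement (-1) (-1) (-1) 0 0;
   Placement 2 0 1 16 0;
   Placement 2 0 1 28 0;
   Placement 2 0 1 40 0;
   Placement 1 1 1 18 2;
   Placement 2 0 1 28 8;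
   Placement (-2) 0 1 36 8;
   Placement 2 0 1 40 8;
   Placement (-2) 0 1 48 8;
   Placement (-1) (-1) 1 10 10;
   Placement 2 0 1 16 16;
   Placement (-1) (-1) 1 16 16;
   Placement (-2) 0 (-1) 16 16;
   Placement 2 0 1 28 16;
   Placement (-2) 0 1 36 16;
   Placement 2 0 1 40 16;
   Placement (-2) 0 1 48 16;
   Placement (-1) (-1) (-1) 24 24;
   Placement (-2) 0 1 36 24;
   Placement 2 0 1 40 24;
   Placement (-2) 0 1 48 24;
   Placement 1 1 1 42 26;
   Placement (-1) (-1) 1 34 34;
   Placement (-1) (-1) 1 40 40;
   Placement (-2) 0 (-1) 40 40].

Lemma tiling_well_placed : all well_placed tiling.
Proof. by vm_compute. Qed.

Lemma tiling_separated : pairwise separated tiling.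
Proof. by vm_compute. Qed.

Section Tiling.
Variable R : realType.
Let r : R := Num.sqrt 3.
Let r_gt0 : 0 < r. Proof. by rewrite sqrtr_gt0. Qed.
Let r_sq : r ^+ 2 = 3. Proof. by rewrite sqr_sqrtr. Qed.

Definition place (t : placement) : R * R -> R * R :=
  let cs := (pcos t)%:~R in let sn := (psin t)%:~R in let fl := (pflip t)%:~R in
  affine_map (cs * fl / 10) (- (fl * (r * sn * fl / 10))) ((pabs t)%:~R / 80)
    (r * sn * fl / 10) (fl * (cs * fl / 10)) (r * (pord t)%:~R / 80).

Lemma well_placedP t : well_placed t ->
  [/\ (pcos t)%:~R ^+ 2 + 3 * (psin t)%:~R ^+ 2 = 4 :> R,
    (pflip t)%:~R ^+ 2 = 1 :> R &
    all (fun v => [&& 0 <= v.2, v.2 <= 40, v.1 <= 50 & v.2 <= v.1]) (vertices t)].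
Proof.
move=> /and3P[/eqP h1 /eqP h2 h3]; split=> //.
  by rewrite -!rmorphXn -[3]/(3%:~R) -rmorphM -rmorphD h1.
by rewrite -rmorphXn h2.
Qed.

Lemma place_similarity t : well_placed t -> similarity (1 / 5) (place t).
Proof.
move=> /well_placedP[h1 h2 _] p q.
rewrite /Defs.edist -[X in _ = X * _]ger0_norm; last lra.
rewrite -sqrtr_sqr -sqrtrM ?sqr_ge0 //; congr Num.sqrt.
rewrite /place /affine_map /=.
move: (pcos t)%:~R (psin t)%:~R (pflip t)%:~R h1 h2 => cs sn fl h1 h2.
set x := p.1 - q.1; set y := p.2 - q.2.
transitivity ((fl ^+ 2 * cs ^+ 2 + r ^+ 2 * (fl ^+ 2 * sn ^+ 2)) / 100 * x ^+ 2
  + fl ^+ 2 * (fl ^+ 2 * cs ^+ 2 + r ^+ 2 * (fl ^+ 2 * sn ^+ 2)) / 100 * y ^+ 2).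
  by rewrite /x /y; field.
by rewrite h2 r_sq !mul1r h1; field.
Qed.

(** Carries the computations on integer vertices over to the real tile: in the
    coordinates 80 x and 80 y / r the placement sends the vertices of the
    trapezoid to the integer vertices, and an affine form is largest at a
    vertex. *)
Lemma place_form_le t d m : well_placed t ->
  all (fun v => form d v <= m) (vertices t) ->
  forall p, trapezoid p ->
    d.1%:~R * 80 * (place t p).1 + d.2%:~R * 80 / r * (place t p).2
      + - m%:~R <= 0 :> R.
Proof.
move=> /well_placedP[_ h2 _] /allP hv p Tp.
pose cs : R := (pcos t)%:~R; pose sn : R := (psin t)%:~R.
pose fl : R := (pflip t)%:~R; pose d1 : R := d.1%:~R; pose d2 : R := d.2%:~R.
pose X : R := (pabs t)%:~R; pose Y : R := (pord t)%:~R.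
have V (a b : nat) : vertex t (a%:Z, b%:Z) \in vertices t ->
    d1 * (cs * fl * a%:R - 3 * sn * b%:R + X)
    + d2 * (sn * fl * a%:R + cs * b%:R + Y) <= m%:~R.
  move=> /hv; rewrite -(ler_int R); congr (_ <= _).
  by rewrite /form /vertex /= !(rmorphD, rmorphM, rmorphN).
have {V} [v1 v2 v3 v4] : [/\ d1 * X + d2 * Y <= m%:~R,
    d1 * (cs * fl * 4 - 3 * sn * 4 + X) + d2 * (sn * fl * 4 + cs * 4 + Y) <= m%:~R,
    d1 * (cs * fl * 5 - 3 * sn * 4 + X) + d2 * (sn * fl * 5 + cs * 4 + Y) <= m%:~R
    & d1 * (cs * fl * 5 + X) + d2 * (sn * fl * 5 + Y) <= m%:~R].
  have v (a b : nat) := map_f (vertex t) (x := (a%:Z, b%:Z))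
    (s := [:: (0, 0); (4, 4); (5, 4); (5, 0)]).
  have := V 0 0 (v 0 0 isT); have := V 4 4 (v 4 4 isT).
  have := V 5 4 (v 5 4 isT); have := V 5 0 (v 5 0 isT).
  by rewrite !mulr0 => ? ? ? ?; split; lra.
rewrite /place /affine_map /= -/cs -/sn -/fl -/d1 -/d2 -/X -/Y.
have rn0 : r != 0 by rewrite gt_eqF.
pose A := 8 * (d1 * (cs * fl) + d2 * (sn * fl)).
pose B := 8 * (d2 * cs / r - d1 * (r * sn)).
have Br : B * (r / 2) = 4 * (d2 * cs - 3 * d1 * sn).
  by rewrite /B -r_sq; field.
have H : A * p.1 + B * p.2 + (d1 * X + d2 * Y - m%:~R) <= 0.
  by apply: trapezoid_affine_le0 => //; rewrite -/r ?Br /A; lra.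
apply: le_trans H; rewrite le_eqVlt; apply/orP; left; apply/eqP.
have -> : B * p.2 = fl ^+ 2 * (B * p.2) by rewrite h2 mul1r.
by rewrite /A /B; field.
Qed.

Lemma place_sub t : well_placed t -> place t @` trapezoid `<=` trapezoid.
Proof.
move=> wt _ [p Tp <-]; have [_ _ /allP hv] := well_placedP _ wt.
have H (d : int * int) m : (forall v : int * int,
      [&& 0 <= v.2, v.2 <= 40, v.1 <= 50 & v.2 <= v.1] -> form d v <= m) ->
    d.1%:~R * 80 * (place t p).1 + d.2%:~R * 80 / r * (place t p).2
      + - m%:~R <= 0 :> R.
  by move=> hd; apply: place_form_le => //; apply/allP => v /hv /hd.
have h1 := H (0, -1) 0 ltac:(by rewrite /form => v /and4P[? ? ? ?] /=; lra).
have h2 := H (0, 1) 40 ltac:(by rewrite /form => v /and4P[? ? ? ?] /=; lra).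
have h3 := H (1, 0) 50 ltac:(by rewrite /form => v /and4P[? ? ? ?] /=; lra).
have h4 := H (-1, 1) 0 ltac:(by rewrite /form => v /and4P[? ? ? ?] /=; lra).
clear H; move: (place t p) h1 h2 h3 h4 => [x y].
have rn0 : r != 0 by rewrite gt_eqF.
have -> : y = r * (y / r) by field.
move: (y / r) => w.
have E : 80 / r * (r * w) = 80 * w by field.
rewrite /= -!mulrA [r^-1 * _]mulKf // => h1 h2 h3 h4.
have [w0 w1 x1 wx] : [/\ 0 <= w, w <= 1 / 2, x <= 5 / 8 & w <= x].
  by split; lra.
split=> //=; rewrite -/r; first by rewrite mulr_ge0 // ltW.
  by rewrite ler_pM2l //; lra.
by rewrite ler_pM2l.
Qed.

(** The line that separates the vertices separates the tiles, and it contains no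
    interior point of the first one. *)
Lemma separated_interiors t t' : well_placed t -> well_placed t' -> separated t t' ->
  interior (place t @` trapezoid) `&` interior (place t' @` trapezoid) = set0.
Proof.
move=> wt wt' /hasP[d dd /hasP[v0 _ /andP[s1 s2]]].
rewrite -subset0 => p [ip /interior_subset[q Tq qp]].
have r0 : 0 < 80 / r by rewrite divr_gt0.
have lt0 : d.1%:~R * 80 * p.1 + d.2%:~R * 80 / r * p.2 + - (form d v0)%:~R < 0.
  apply: interior_half_plane ip; last by move=> _ [x Tx <-]; exact: place_form_le.
  have /allP/(_ d dd) : all (fun d => (d.1 != 0) || (d.2 != 0)) directions by [].
  have n80 : 80 != 0 :> R by rewrite pnatr_eq0.
  have nr : r^-1 != 0 by rewrite invr_neq0 // gt_eqF.
  case/orP=> dn; apply/orP; [left|right]; first by rewrite mulf_neq0 ?intr_eq0.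
  by rewrite mulf_neq0 // mulf_neq0 ?intr_eq0.
have := @place_form_le t' (- d.1, - d.2) (- form d v0) wt' _ q Tq.
rewrite qp !rmorphN => h.
suff : - d.1%:~R * 80 * p.1 + - d.2%:~R * 80 / r * p.2 + - - (form d v0)%:~R <= 0 by lra.
apply: h; apply/allP => v /(allP s2); rewrite -lerN2; congr (_ <= _).
by rewrite /form /=; ring.
Qed.

Theorem rep_trapezoid : rep 25 (trapezoid : set (R * R)).
Proof.
have st : size tiling = 25%N by [].
pose t (i : 'I_25) := nth (Placement 2 0 1 0 0) tiling i.
have wt i : well_placed (t i).
  by apply: (all_nthP _ tiling_well_placed); rewrite st.
have fc i := place_similarity _ (wt i).
have c0 : 0 < 1 / 5 :> R by lra.
have disj : trivIset [set: 'I_25] (fun i => interior (place (t i) @` trapezoid)).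
  have lt_disj (i j : 'I_25) : (i < j)%N ->
      interior (place (t i) @` trapezoid) `&` interior (place (t j) @` trapezoid) = set0.
    move=> ij; apply: separated_interiors => //.
    have /(pairwiseP (Placement 2 0 1 0 0)) sepP := tiling_separated.
    by apply: sepP => //; rewrite inE st.
  move=> i j _ _ [p pij]; apply/val_inj/eqP/negP => /negP.
  case: ltngtP => // ij _; have := lt_disj _ _ ij; rewrite -subset0; apply.
    exact: pij.
  by case: pij => ? ?; split; eassumption.
exists (fun i => place (t i) @` trapezoid); split.
- split=> //; apply/seteqP; split; first by move=> p [i _]; exact: place_sub.
  by apply: area_filling c0 fc _ _ disj => [|i]; [lra|exact: place_sub].
- by move=> i; exists (1 / 5), (place (t i)).
- move=> i j.
  (* Go back to the trapezoid from the tile i, then forward to the tile j. *)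
  have [a [b [e [c [d [h [_ fK gK]]]]]]] := similarity_inverse _ _ _ c0 (fc i).
  set g := affine_map _ _ _ _ _ _ in fK gK.
  exists (place (t j) \o g).
    move=> p q; rewrite /= fc -{2}(gK p) -{2}(gK q) fc; lra.
  rewrite image_comp; congr (_ @` _).
  by apply/funext => p /=; rewrite fK.
Qed.
End Tiling.

Theorem theorem3p7 (R : realType) :
  rep 25 (right_trapezoid (pi / 3 : R) (1 / 8)) /\
  (forall n : nat, (1 < n < 25)%N ->
     ~ rep n (right_trapezoid (pi / 3 : R) (1 / 8))).
Proof.
rewrite right_trapezoidE; split; first exact: rep_trapezoid.
exact: not_rep_trapezoid.
Qed.
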